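(* Let $G$ be a simple, simply-connected linear algebraic group over $\mathbb{C}$ of rank $r$, let $\lambda$ be a dominant weight, and let $I,J$ be disjoint sets with $I\sqcup J=\{1,\dots,r\}$. Let $W_I$ be the subgroup of the Weyl group $W$ generated by the simple reflections $s_i$, $i\in I$. Then $$v_{I,J}(\lambda)=\frac{1}{|W_I|}\sum_{w\in W_I}w\lambda.$$
   Context: Fix a maximal torus and Borel subgroup $T\subset B\subset G$, with simple roots $\alpha_1,\dots,\alpha_r$, simple coroots $\alpha_1^\vee,\dots,\alpha_r^\vee$, and fundamental coweights $x_1,\dots,x_r\in X_*(T)\otimes\mathbb{Q}$ dual to the simple roots ($\langle\alpha_i,x_j\rangle=\delta_{ij}$). For $I\sqcup J=\{1,\dots,r\}$, the point $v_{I,J}(\lambda)\in X^*(T)\otimes\mathbb{Q}$ is the unique solution $x$ of the linear system $\langle x,\alpha_i^\vee\rangle=0$ for all $i\in I$, and $\langle\lambda-x,x_j\rangle=0$ for all $j\in J$ (the solution exists and is unique because $\{\alpha_i^\vee\}_{i\in I}\cup\{x_j\}_{j\in J}$ is a basis). *)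

(* Defs.v *)
From HB Require Import structures.
From mathcomp Require Import all_boot all_order all_algebra.
From mathcomp Require Import finmap complex mpoly.
From mathcomp Require Import boolp classical_sets cardinality reals.

Set Implicit Arguments.
Unset Strict Implicit.
Unset Printing Implicit Defensive.

Import Order.TTheory GRing.Theory Num.Theory.
Local Open Scope classical_set_scope.
Local Open Scope ring_scope.

(* Linear algebraic groups are Zariski closed subgroups of some GL_n(K),
   identified with their sets of K-points.  The field K is algebraically closed
   of characteristic 0; the theorem takes K = R[i], i.e. the complex numbers. *)

Section LinearAlgebraicGroups.
Variable K : numClosedFieldType.

Definition evalmx n (p : {mpoly K[n * n]}) (A : 'M[K]_n) : K :=
  p.@[fun k => mxvec A 0 k].

Definition GL n : set 'M[K]_n := [set A | A \in unitmx].

(* Equations in the matrix entries suffice: a regular function on GL_n is a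
   polynomial in the entries divided by a power of the determinant. *)
Definition zariski_closed n (S : set 'M[K]_n) : Prop :=
  exists F : set {mpoly K[n * n]},
    S = @GL n `&` [set A | forall p, F p -> evalmx p A = 0].

Definition zariski_connected n (S : set 'M[K]_n) : Prop :=
  forall A B : set 'M[K]_n, zariski_closed A -> zariski_closed B ->
    S `<=` A `|` B -> S `&` A `&` B = set0 -> S `<=` A \/ S `<=` B.

Definition mx_subgroup n (H : set 'M[K]_n) : Prop :=
  [/\ H `<=` @GL n, H 1%:M,
      forall a b, H a -> H b -> H (a *m b)
    & forall a, H a -> H (invmx a)].

Definition alg_group n (G : set 'M[K]_n) : Prop :=
  zariski_closed G /\ mx_subgroup G.

Definition regular_on n (S : set 'M[K]_n) (f : 'M[K]_n -> K) : Prop :=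
  exists (p : {mpoly K[n * n]}) (N : nat),
    forall A, S A -> f A = evalmx p A / (\det A) ^+ N.

(* Only the restriction of f to G is relevant. *)
Definition alg_morphism n m (G : set 'M[K]_n) (H : set 'M[K]_m)
    (f : 'M[K]_n -> 'M[K]_m) : Prop :=
  [/\ forall a, G a -> H (f a),
      forall a b, G a -> G b -> f (a *m b) = f a *m f b
    & forall i j, regular_on G (fun a => f a i j)].

Definition alg_isomorphism n m (G : set 'M[K]_n) (H : set 'M[K]_m)
    (f : 'M[K]_n -> 'M[K]_m) : Prop :=
  alg_morphism G H f /\
  exists g : 'M[K]_m -> 'M[K]_n,
    [/\ alg_morphism H G g,
        forall a, G a -> g (f a) = a
      & forall b, H b -> f (g b) = b].

Definition normal_in n (N G : set 'M[K]_n) : Prop :=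
  forall g a, G g -> N a -> N (g *m a *m invmx g).

(* "Simple" in the sense of algebraic groups: the centre may be nontrivial. *)
Definition simple_group n (G : set 'M[K]_n) : Prop :=
  [/\ alg_group G, zariski_connected G,
      ~ (forall a b, G a -> G b -> a *m b = b *m a)
    & forall N : set 'M[K]_n, alg_group N -> zariski_connected N ->
        N `<=` G -> normal_in N G -> N = [set 1%:M] \/ N = G].

(* Every isogeny from a connected group is an isomorphism; in characteristic 0
   isogenies of connected groups are automatically central. *)
Definition simply_connected n (G : set 'M[K]_n) : Prop :=
  forall m (G' : set 'M[K]_m) (f : 'M[K]_m -> 'M[K]_n),
    alg_group G' -> zariski_connected G' ->
    alg_morphism G' G f -> f @` G' = G ->
    finite_set (G' `&` [set a | f a = 1%:M]) ->
    alg_isomorphism G' G f.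

Definition diag_group r : set 'M[K]_r := [set A | (A \in unitmx) && is_diag_mx A].

Definition torus_of_dim r n (T : set 'M[K]_n) : Prop :=
  alg_group T /\ exists f, alg_isomorphism (@diag_group r) T f.

Definition is_torus n (T : set 'M[K]_n) : Prop := exists r, torus_of_dim r T.

Definition maximal_torus n (G T : set 'M[K]_n) : Prop :=
  [/\ is_torus T, T `<=` G
    & forall S : set 'M[K]_n, is_torus S -> S `<=` G -> T `<=` S -> S = T].

Definition derived_subgroup n (H : set 'M[K]_n) : set 'M[K]_n :=
  [set c | forall S : set 'M[K]_n, mx_subgroup S ->
     (forall a b, H a -> H b -> S (a *m b *m invmx a *m invmx b)) -> S c].

Definition solvable_group n (H : set 'M[K]_n) : Prop :=
  exists k, iter k (@derived_subgroup n) H `<=` [set 1%:M].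

Definition connected_solvable n (H : set 'M[K]_n) : Prop :=
  [/\ alg_group H, zariski_connected H & solvable_group H].

Definition borel_subgroup n (G B : set 'M[K]_n) : Prop :=
  [/\ connected_solvable B, B `<=` G
    & forall S : set 'M[K]_n,
        connected_solvable S -> S `<=` G -> B `<=` S -> S = B].

(* Tangent space at the identity: matrices killed by the differential at 1 of
   every polynomial vanishing on G. *)
Definition lie_algebra n (G : set 'M[K]_n) : set 'M[K]_n :=
  [set X | forall p : {mpoly K[n * n]}, (forall A, G A -> evalmx p A = 0) ->
     \sum_(k < n * n) evalmx p^`M(k) 1%:M * mxvec X 0 k = 0].

(* The multiplicative group is GL_1, with z in K^* standing for z%:M.  Only the
   values of a character on T, and of a cocharacter on K^*, are relevant. *)
Definition is_character n (T : set 'M[K]_n) (chi : 'M[K]_n -> K) : Prop :=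
  alg_morphism T (@GL 1) (fun t => (chi t)%:M).

Definition is_cocharacter n (T : set 'M[K]_n) (mu : K -> 'M[K]_n) : Prop :=
  alg_morphism (@GL 1) T (fun z => mu (z 0 0)).

Definition is_root n (G T : set 'M[K]_n) (chi : 'M[K]_n -> K) : Prop :=
  [/\ is_character T chi,
      exists2 t, T t & chi t != 1
    & exists X, [/\ lie_algebra G X, X != 0
        & forall t, T t -> t *m X *m invmx t = chi t *: X]].

(* The positive roots are the roots of B. *)
Definition is_simple_root n (B T : set 'M[K]_n) (chi : 'M[K]_n -> K) : Prop :=
  is_root B T chi /\
  ~ (exists psi1 psi2, [/\ is_root B T psi1, is_root B T psi2
       & forall t, T t -> chi t = psi1 t * psi2 t]).

Definition enumerates_simple_roots n (B T : set 'M[K]_n) r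
    (alpha : 'I_r -> 'M[K]_n -> K) : Prop :=
  (forall i, is_simple_root B T (alpha i)) /\
  (forall chi, is_simple_root B T chi ->
     exists! i, forall t, T t -> chi t = alpha i t).

Definition SL2 : set 'M[K]_2 := [set A | \det A = 1].
Definition upper2 (a : K) : 'M[K]_2 := 1%:M + a *: delta_mx 0 1.
Definition lower2 (a : K) : 'M[K]_2 := 1%:M + a *: delta_mx 1 0.
Definition torus2 (z : K) : 'M[K]_2 :=
  z *: delta_mx 0 0 + z^-1 *: delta_mx 1 1.

(* The coroot of chi is z |-> phi (diag (z, z^-1)) for a morphism phi from SL_2
   to G mapping the upper and lower unipotent matrices isomorphically and
   T-equivariantly to the root subgroups of chi and -chi. *)
Definition is_coroot n (G T : set 'M[K]_n) (chi : 'M[K]_n -> K)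
    (mu : K -> 'M[K]_n) : Prop :=
  is_cocharacter T mu /\
  exists phi : 'M[K]_2 -> 'M[K]_n,
    [/\ alg_morphism SL2 G phi,
        forall a, (phi (upper2 a) = 1%:M -> a = 0) /\
                  (phi (lower2 a) = 1%:M -> a = 0),
        forall t a, T t ->
          t *m phi (upper2 a) *m invmx t = phi (upper2 (chi t * a)),
        forall t a, T t ->
          t *m phi (lower2 a) *m invmx t = phi (lower2 ((chi t)^-1 * a))
      & forall z, z != 0 -> mu z = phi (torus2 z)].

(* XQ and YQ are the rationalizations of the character and cocharacter lattices
   of T (X^*(T) (x) Q and X_*(T) (x) Q), presented by their defining property:
   the canonical map is an injective homomorphism, and every vector has a
   positive integral multiple in its image.  The pairing extends the integral
   one, chi (mu z) = z ^ <chi, mu>.  All this is unique up to a unique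
   isomorphism. *)
Record rational_lattices n (T : set 'M[K]_n) := RationalLattices {
  XQ : vectType rat;
  YQ : vectType rat;
  wt : ('M[K]_n -> K) -> XQ;
  cowt : (K -> 'M[K]_n) -> YQ;
  pairing : 'Hom(XQ, 'Hom(YQ, rat^o));
  wtM : forall chi psi, is_character T chi -> is_character T psi ->
    wt (fun t => chi t * psi t) = wt chi + wt psi;
  wt_eq : forall chi psi, is_character T chi -> is_character T psi ->
    (wt chi = wt psi <-> forall t, T t -> chi t = psi t);
  wt_span : forall x : XQ, exists k chi,
    [/\ (0 < k)%N, is_character T chi & x *+ k = wt chi];
  cowtM : forall mu nu, is_cocharacter T mu -> is_cocharacter T nu ->
    cowt (fun z => mu z *m nu z) = cowt mu + cowt nu;
  cowt_eq : forall mu nu, is_cocharacter T mu -> is_cocharacter T nu ->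
    (cowt mu = cowt nu <-> forall z, z != 0 -> mu z = nu z);
  cowt_span : forall y : YQ, exists k mu,
    [/\ (0 < k)%N, is_cocharacter T mu & y *+ k = cowt mu];
  pairingE : forall chi mu, is_character T chi -> is_cocharacter T mu ->
    exists2 m : int, pairing (wt chi) (cowt mu) = m%:~R
      & forall z, z != 0 -> chi (mu z) = z ^ m }.

Section Weyl.
Variables (n : nat) (G T : set 'M[K]_n) (L : rational_lattices T).

Definition normalizer : set 'M[K]_n :=
  [set g | G g /\ forall t, T t <-> T (g *m t *m invmx g)].

(* N_G(T) acts on characters by (g chi)(t) = chi (g^-1 t g); the Weyl group is
   realized faithfully as the group of automorphisms of XQ so obtained. *)
Definition weyl_group : set 'End(XQ L) :=
  [set w | exists2 g, normalizer g
     & forall chi, is_character T chi ->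
         w (wt L chi) = wt L (fun t => chi (invmx g *m t *m g))].

Definition end_subgroup (H : set 'End(XQ L)) : Prop :=
  [/\ H \1%VF, forall u w, H u -> H w -> H (u \o w)%VF
    & forall w, H w -> H (w^-1)%VF].

Definition reflection (chi : 'M[K]_n -> K) (mu : K -> 'M[K]_n) : 'End(XQ L) :=
  linfun (fun x => x - pairing L x (cowt L mu) *: wt L chi).

Definition weyl_parabolic r (alpha : 'I_r -> 'M[K]_n -> K)
    (alphav : 'I_r -> K -> 'M[K]_n) (I : {set 'I_r}) : set 'End(XQ L) :=
  [set w | forall H : set 'End(XQ L), end_subgroup H -> H `<=` weyl_group ->
     (forall i, i \in I -> H (reflection (alpha i) (alphav i))) -> H w].

Definition vIJ r (alphav : 'I_r -> K -> 'M[K]_n) (x : 'I_r -> YQ L)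
    (I J : {set 'I_r}) (lambda : 'M[K]_n -> K) : XQ L :=
  xget 0 [set v |
    (forall i, i \in I -> pairing L v (cowt L (alphav i)) = 0) /\
    (forall j, j \in J -> pairing L (wt L lambda - v) (x j) = 0)].

Definition dominant r (alphav : 'I_r -> K -> 'M[K]_n)
    (lambda : 'M[K]_n -> K) : Prop :=
  forall i, 0 <= (pairing L (wt L lambda) (cowt L (alphav i)) : rat).

End Weyl.
End LinearAlgebraicGroups.

Arguments GL {K} n.
Arguments SL2 {K}.
Arguments weyl_group {K n} G {T} L.
Arguments reflection {K n T} L chi mu.
Arguments weyl_parabolic {K n} G {T} L {r} alpha alphav I.
Arguments vIJ {K n T} L {r} alphav x I J lambda.

(* Main.v *)
From HB Require Import structures.
Require Import Defs.
From mathcomp Require Import all_boot all_order all_algebra.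
From mathcomp Require Import finmap complex mpoly.
From mathcomp Require Import boolp classical_sets cardinality reals.
From mathcomp Require Import ring.

(* The finite group W_I is generated by the reflections s_i, i in I, so the
   average v of W_I lambda is fixed by every s_i, i.e. orthogonal to the coroots
   of I; and lambda - v is a combination of the roots of I, which the x_j, j in
   J, kill.  For uniqueness, the difference u of two solutions lies in the span
   of the roots of I and is fixed by W_I; but the average of w alpha_i over W_I
   vanishes since s_i alpha_i = - alpha_i, so u, being its own average, is 0.

   Everything else is extracted from the group.  That s_i comes from N_G(T) is a
   computation with the morphism from SL_2.  The characters of a torus of
   dimension r are monomials, so X^*(T) has rank at most r and is rationally
   spanned by the simple roots.  Hence the Weyl group, which permutes the
   finitely many weights of T acting by conjugation on all n x n matrices (a set
   containing the roots), is finite. *)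

Set Implicit Arguments.
Unset Strict Implicit.
Unset Printing Implicit Defensive.

Import Order.TTheory GRing.Theory Num.Theory.
Local Open Scope ring_scope.
Local Open Scope complex_scope.

(** * Laurent polynomials as functions on the punctured line *)

Section Laurent.
Variable K : numClosedFieldType.
Implicit Types u v : K -> K.

(** Nothing is required at [z = 0], where the inverse takes a default value. *)
Definition laurent u :=
  exists (P : {poly K}) (N : nat), forall z, z != 0 -> u z = P.[z] / z ^+ N.

Lemma laurent_cst c : laurent (fun=> c).
Proof. by exists c%:P, 0%N => z _; rewrite hornerC expr0 divr1. Qed.

Lemma laurent_id : laurent id.
Proof. by exists 'X, 0%N => z _; rewrite hornerX expr0 divr1. Qed.

Lemma eq_laurent u v :
  (forall z, z != 0 -> u z = v z) -> laurent v -> laurent u.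
Proof. by move=> e [P [N ev]]; exists P, N => z z0; rewrite e // ev. Qed.

Lemma laurentXV k N : laurent (fun z => z ^+ k / z ^+ N).
Proof. by exists 'X^k, N => z _; rewrite hornerXn. Qed.

Lemma laurentD u v : laurent u -> laurent v -> laurent (fun z => u z + v z).
Proof.
move=> [P [N Pu]] [Q [M Qv]]; exists (P * 'X^M + Q * 'X^N), (N + M)%N => z z0.
rewrite Pu ?Qv // !hornerE exprD; field.
by rewrite !expf_neq0.
Qed.

Lemma laurentM u v : laurent u -> laurent v -> laurent (fun z => u z * v z).
Proof.
move=> [P [N Pu]] [Q [M Qv]]; exists (P * Q), (N + M)%N => z z0.
by rewrite Pu ?Qv // hornerM exprD; field; rewrite !expf_neq0.
Qed.

Lemma laurentX u k : laurent u -> laurent (fun z => u z ^+ k).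
Proof.
move=> lu; elim: k => [|k IH]; first exact: laurent_cst.
rewrite (_ : (fun _ => _) = fun z => u z * u z ^+ k); first exact: laurentM.
by apply: funext => z; rewrite exprS.
Qed.

Lemma laurent_sum (I : Type) (s : seq I) (F : I -> K -> K) :
  (forall i, laurent (F i)) -> laurent (fun z => \sum_(i <- s) F i z).
Proof.
move=> lF; elim: s => [|i s IH].
  by under eq_fun do rewrite big_nil; exact: laurent_cst.
by under eq_fun do rewrite big_cons; exact: laurentD.
Qed.

Lemma laurent_prod (I : Type) (s : seq I) (F : I -> K -> K) :
  (forall i, laurent (F i)) -> laurent (fun z => \prod_(i <- s) F i z).
Proof.
move=> lF; elim: s => [|i s IH].
  by under eq_fun do rewrite big_nil; exact: laurent_cst.
by under eq_fun do rewrite big_cons; exact: laurentM.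
Qed.

Lemma laurent_det n (A : K -> 'M[K]_n) :
  (forall i j, laurent (fun z => A z i j)) -> laurent (fun z => \det (A z)).
Proof.
move=> lA; apply: laurent_sum => s; apply: laurentM; first exact: laurent_cst.
exact: laurent_prod.
Qed.

Lemma laurent_evalmx n (p : {mpoly K[n * n]}) (A : K -> 'M[K]_n) :
  (forall i j, laurent (fun z => A z i j)) -> laurent (fun z => evalmx p (A z)).
Proof.
move=> lA; rewrite /evalmx; under eq_fun do rewrite mevalE.
apply: laurent_sum => m; apply: laurentM; first exact: laurent_cst.
apply: laurent_prod => k; apply: laurentX.
case/mxvec_indexP: k => i j; under eq_fun do rewrite mxvecE.
exact: lA.
Qed.

(* Comparing coefficients of z in P(z w) = P(z) P(w) shows that P(w) = w^k for
   every k in the support of P. *)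
Lemma laurent_hom u : laurent u -> (forall z, z != 0 -> u z != 0) ->
  (forall z w, z != 0 -> w != 0 -> u (z * w) = u z * u w) ->
  exists k N, forall z, z != 0 -> u z = z ^+ k / z ^+ N.
Proof.
move=> [P [N Pu]] u0 uM.
have PM z w : z != 0 -> w != 0 -> P.[z * w] = P.[z] * P.[w].
  move=> z0 w0; move: (uM z w z0 w0); rewrite !Pu ?mulf_neq0 // exprMn => e.
  apply: (@mulIf _ (z ^+ N * w ^+ N)^-1).
    by rewrite invr_eq0 mulf_neq0 ?expf_neq0.
  by rewrite e; field; rewrite !expf_neq0.
have P0 : P != 0.
  apply/eqP => P0; have := u0 1 (oner_neq0 _).
  by rewrite Pu ?oner_neq0 // P0 horner0 mul0r eqxx.
(* The comparison is made in the degree of [P], where the coefficient is nonzero. *)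
exists (size P).-1, N => w w0; rewrite Pu //; congr (_ / _).
have /polyP/(_ (size P).-1) : P \Po (w *: 'X) = P.[w] *: P.
  apply/eqP; rewrite -subr_eq0; apply/negPn/negP => Q0.
  pose Q := P \Po (w *: 'X) - P.[w] *: P.
  (* In characteristic 0 the integers [1, ..., size Q] are distinct nonzero roots of [Q], one more
     than its degree allows. *)
  have := max_poly_roots (p := Q) (rs := [seq i.+1%:R | i <- iota 0 (size Q)]) Q0.
  rewrite size_map size_iota ltnn => F; suff: false by [].
  apply: F.
    apply/allP => z /mapP[i _ ->]; rewrite rootE /Q hornerD hornerN hornerZ.
    rewrite horner_comp hornerZ hornerX PM ?pnatr_eq0 ?w0 //.
    by rewrite subrr.
  rewrite map_inj_uniq ?iota_uniq // => i j /eqP.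
  by rewrite eqr_nat eqSS => /eqP.
rewrite comp_polyE coef_sum.
rewrite (eq_bigr (fun i : 'I_(size P) => P`_i * w ^+ i * ((size P).-1 == i)%:R)).
  have lt : ((size P).-1 < size P)%N by rewrite prednK // lt0n size_poly_eq0.
  rewrite (bigD1 (Ordinal lt)) //= eqxx mulr1 big1 ?addr0; last first.
    move=> i; rewrite -val_eqE /= eq_sym => /negPf ->; by rewrite mulr0.
  rewrite coefZ [RHS]mulrC => /mulfI -> //.
  by rewrite -lead_coefE lead_coef_eq0.
by move=> i _; rewrite exprZn !coefZ coefXn mulrA.
Qed.

End Laurent.

Lemma invmxM (K : fieldType) n (A B : 'M[K]_n) :
  A \in unitmx -> B \in unitmx -> invmx (A *m B) = invmx B *m invmx A.
Proof.
move=> uA uB; have uAB : A *m B \in unitmx by rewrite unitmx_mul uA.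
apply: (can_inj (mulKmx uAB)).
by rewrite mulmxV // -mulmxA (mulmxA B) mulmxV // mul1mx mulmxV.
Qed.

(** * Characters of [T] and their weights *)

Section Characters.
Variables (K : numClosedFieldType) (n : nat) (T : set 'M[K]_n).
Implicit Types (chi psi : 'M[K]_n -> K) (a b t g : 'M[K]_n).

Lemma subgroup_unit (H : set 'M[K]_n) t : mx_subgroup H -> H t -> t \in unitmx.
Proof. by case=> sub _ _ _ Ht; exact: sub. Qed.

Lemma characterM chi a b : is_character T chi -> T a -> T b ->
  chi (a *m b) = chi a * chi b.
Proof.
case=> _ M _ Ta Tb; have := M _ _ Ta Tb.
by rewrite -scalar_mxM => /matrixP/(_ 0 0); rewrite !mxE eqxx !mulr1n.
Qed.

Lemma character_neq0 chi t : is_character T chi -> T t -> chi t != 0.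
Proof.
by case=> U _ _ /U; rewrite /GL /= unitmxE det_scalar1 unitfE.
Qed.

Lemma character_regular chi : is_character T chi -> regular_on T chi.
Proof.
case=> _ _ /(_ 0 0) [p [N e]]; exists p, N => A TA.
by rewrite -e // mxE eqxx mulr1n.
Qed.

Lemma is_characterP chi : (forall t, T t -> chi t != 0) ->
  (forall a b, T a -> T b -> chi (a *m b) = chi a * chi b) ->
  regular_on T chi -> is_character T chi.
Proof.
move=> chi0 chiM [p [N e]]; split.
- by move=> t /chi0; rewrite /GL /= unitmxE det_scalar1 unitfE.
- by move=> a b Ta Tb; rewrite chiM // scalar_mxM.
- by move=> i j; exists p, N => A TA; rewrite -e // mxE !ord1 eqxx mulr1n.
Qed.

Lemma is_character_cst1 : is_character T (fun=> 1).
Proof.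
apply: is_characterP => [*|*|]; [exact: oner_neq0|by rewrite mulr1|].
by exists 1, 0%N => A _; rewrite /evalmx rmorph1 expr0 divr1.
Qed.

Lemma is_characterM chi psi : is_character T chi -> is_character T psi ->
  is_character T (fun t => chi t * psi t).
Proof.
move=> cchi cpsi; apply: is_characterP.
- by move=> t Tt; rewrite mulf_neq0 ?character_neq0.
- by move=> a b Ta Tb; rewrite !characterM // mulrACA.
have [p [N ep]] := character_regular cchi.
have [q [M eq]] := character_regular cpsi.
exists (p * q), (N + M)%N => A TA.
by rewrite ep // eq // /evalmx mevalM exprD invfM mulrACA.
Qed.

Lemma is_characterX chi k : is_character T chi ->
  is_character T (fun t => chi t ^+ k).
Proof.
move=> cchi; elim: k => [|k IH]; first exact: is_character_cst1.
rewrite (_ : (fun _ => _) = fun t => chi t * chi t ^+ k).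
  exact: is_characterM.
by apply: funext => t; rewrite exprS.
Qed.

Lemma is_character_prod (I : Type) (s : seq I) (F : I -> 'M[K]_n -> K) :
  (forall i, is_character T (F i)) ->
  is_character T (fun t => \prod_(i <- s) F i t).
Proof.
move=> cF; elim: s => [|i s IH].
  by under eq_fun do rewrite big_nil; exact: is_character_cst1.
by under eq_fun do rewrite big_cons; exact: is_characterM.
Qed.

(** Conjugation acts linearly on the entries, so the linear forms [q k] are substituted for the
    variables of [p]; the determinant in the denominator does not change. *)
Lemma regular_on_conj chi g : g \in unitmx ->
  (forall t, T t -> T (invmx g *m t *m g)) -> regular_on T chi ->
  regular_on T (fun t => chi (invmx g *m t *m g)).
Proof.
move=> gU stab [p [N e]].
pose f := mulmxr g \o mulmx (invmx g).
pose q k : {mpoly K[n * n]} := \sum_l (lin_mx f l k) *: 'X_l.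
exists (p \mPo [tuple q k | k < n * n]), N => A TA.
rewrite (e _ (stab _ TA)); congr (_ / _ ^+ _).
  rewrite /evalmx comp_mpoly_meval; apply: meval_eq => k.
  rewrite tnth_mktuple -[_ *m g]/(f A) -mul_vec_lin mxE raddf_sum /=.
  by apply: eq_bigr => l _; rewrite mevalZ mevalXU mulrC.
by rewrite !det_mulmx mulrAC det_inv mulVr ?mul1r // -unitmxE.
Qed.

Lemma is_character_conj chi g : g \in unitmx ->
  (forall t, T t -> T (invmx g *m t *m g)) -> is_character T chi ->
  is_character T (fun t => chi (invmx g *m t *m g)).
Proof.
move=> gU stab cchi; apply: is_characterP.
- by move=> t Tt; apply/(character_neq0 cchi)/stab.
- move=> a b Ta Tb; rewrite -characterM //; try exact: stab.
  by rewrite !mulmxA mulmxK.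
- exact/regular_on_conj/character_regular.
Qed.

Variable L : rational_lattices T.

Lemma wt_cst1 : wt L (fun=> 1) = 0.
Proof.
have := wtM L is_character_cst1 is_character_cst1.
under eq_fun do rewrite mulr1.
by move/eqP; rewrite -[X in X == _]addr0 (inj_eq (addrI _)) eq_sym => /eqP.
Qed.

Lemma wtX chi k : is_character T chi ->
  wt L (fun t => chi t ^+ k) = wt L chi *+ k.
Proof.
move=> cchi; elim: k => [|k IH]; first exact: wt_cst1.
rewrite mulrS -IH -wtM //; last exact: is_characterX.
by congr wt; apply: funext => t; rewrite exprS.
Qed.

Lemma wt_prod (I : Type) (s : seq I) (F : I -> 'M[K]_n -> K) :
  (forall i, is_character T (F i)) ->
  wt L (fun t => \prod_(i <- s) F i t) = \sum_(i <- s) wt L (F i).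
Proof.
move=> cF; elim: s => [|i s IH].
  by rewrite big_nil; under eq_fun do rewrite big_nil; exact: wt_cst1.
rewrite big_cons -IH -wtM //; last exact: is_character_prod.
by congr wt; apply: funext => t; rewrite big_cons.
Qed.

End Characters.

(** * Characters of a torus are monomials, which bounds the rank of the lattice *)

Section TorusRank.
Variable K : numClosedFieldType.

(** The inverse determinant needs its own hypothesis, since the inverse of a Laurent polynomial is
    Laurent only for monomials. *)
Lemma regular_laurent n (S : set 'M[K]_n) phi (A : K -> 'M[K]_n) :
  regular_on S phi -> (forall z, z != 0 -> S (A z)) ->
  (forall i j, laurent (fun z => A z i j)) -> laurent (fun z => (\det (A z))^-1) ->
  laurent (phi \o A).
Proof.
move=> [p [N e]] SA lA ldet.
apply: (@eq_laurent _ _ (fun z => evalmx p (A z) * (\det (A z))^-1 ^+ N)).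
  by move=> z z0; rewrite /= (e _ (SA z z0)) exprVn.
by apply: laurentM; [exact: laurent_evalmx | exact: laurentX].
Qed.

Definition diagf r (d : 'I_r -> K) : 'M[K]_r := diag_mx (\row_j d j).

Lemma diagfM r (d e : 'I_r -> K) : diagf d *m diagf e = diagf (fun j => d j * e j).
Proof. by rewrite mulmx_diag; congr diag_mx; apply/rowP => j; rewrite !mxE. Qed.

Lemma diag_groupE r (d : 'I_r -> K) : diag_group (diagf d) <-> forall j, d j != 0.
Proof.
rewrite /diag_group /= diag_mx_is_diag andbT unitmxE det_diag unitfE prodf_seq_neq0.
split=> [/allP d0 j|d0].
  by have := d0 j (mem_index_enum _); rewrite mxE.
by apply/allP => j _; rewrite mxE d0.
Qed.

Lemma diag_groupP r (A : 'M[K]_r) : diag_group A -> A = diagf (fun j => A j j).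
Proof.
case/andP=> _ /diag_mxP[d ->]; congr diag_mx.
by apply/rowP => j; rewrite !mxE eqxx mulr1n.
Qed.

(** Through [diagf], the [i]-th coordinate cocharacter of the diagonal torus. *)
Definition coordf r (i : 'I_r) (z : K) : 'I_r -> K := fun j => if j == i then z else 1.

Lemma coordf_neq0 r (i : 'I_r) z : z != 0 -> forall j, coordf i z j != 0.
Proof. by move=> z0 j; rewrite /coordf; case: ifP; rewrite ?oner_neq0. Qed.

Lemma laurent_coordf r (i a b : 'I_r) : laurent (fun z => diagf (coordf i z) a b).
Proof.
rewrite /diagf /coordf; have [eab|nab] := eqVneq a b; last first.
  apply: eq_laurent (laurent_cst 0) => z _.
  by rewrite !mxE (negPf nab) mulr0n.
have [ei|ni] := eqVneq b i.
  apply: eq_laurent (laurent_id K) => z _.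
  by rewrite !mxE eab ei !eqxx mulr1n.
apply: eq_laurent (laurent_cst 1) => z _.
by rewrite !mxE eab (negPf ni) eqxx mulr1n.
Qed.

Lemma det_coordf r (i : 'I_r) z : \det (diagf (coordf i z)) = z.
Proof.
rewrite det_diag (bigD1 i) //= big1 ?mulr1 => [|j ji].
  by rewrite mxE /coordf eqxx.
by rewrite mxE /coordf (negPf ji).
Qed.

Variables (n r : nat) (T : set 'M[K]_n).

(** Along a coordinate cocharacter, [chi] is a Laurent homomorphism, so [laurent_hom] applies. The
    exponents form one pair so that [choice] can make them a function of [i]. *)
Lemma torus_character_coord f chi (i : 'I_r) : mx_subgroup T ->
  alg_morphism (@diag_group K r) T f -> is_character T chi ->
  exists kN : nat * nat, forall z, z != 0 ->
    chi (f (diagf (coordf i z))) = z ^+ kN.1 / z ^+ kN.2.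
Proof.
move=> T_group [fT fM freg] cchi.
pose A z := f (diagf (coordf i z)).
have D z : z != 0 -> diag_group (diagf (coordf i z)).
  by move=> z0; apply/diag_groupE/coordf_neq0.
have TA z : z != 0 -> T (A z) by move=> z0; apply/fT/D.
have AM z w : z != 0 -> w != 0 -> A (z * w) = A z *m A w.
  move=> z0 w0; rewrite -fM ?diagfM; [|exact: D|exact: D].
  congr (f (diagf _)); apply: funext => j.
  by rewrite /coordf; case: ifP; rewrite ?mulr1.
have lA a b : laurent (fun z => A z a b).
  apply: (regular_laurent (freg a b) D (laurent_coordf i)).
  apply: eq_laurent (laurentXV K 0 1) => z _.
  by rewrite det_coordf expr0 expr1 div1r.
(* The denominator of [chi] is a power of [\det (A z)]. This determinant is multiplicative in [z],
   hence a monomial, and so its inverse is Laurent. *)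
have [k [N detA]] : exists k N, forall z, z != 0 -> \det (A z) = z ^+ k / z ^+ N.
  apply: laurent_hom; first exact: laurent_det.
    by move=> z /TA /(subgroup_unit T_group); rewrite unitmxE unitfE.
  by move=> z w z0 w0; rewrite AM // det_mulmx.
have lchi : laurent (chi \o A).
  apply: regular_laurent (character_regular cchi) TA lA _.
  apply: eq_laurent (laurentXV K N k) => z z0.
  by rewrite detA // invf_div.
have [l [M e]] : exists l M, forall z, z != 0 -> chi (A z) = z ^+ l / z ^+ M.
  apply: laurent_hom lchi _ _.
    by move=> z /TA; exact: character_neq0.
  by move=> z w z0 w0 /=; rewrite AM // (characterM cchi) //; exact: TA.
by exists (l, M).
Qed.

(** The [r] coordinates [e i] of the torus span [XQ L], because every character is a monomial in
    them. *)
Lemma dim_XQ_le (L : rational_lattices T) : torus_of_dim r T ->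
  (\dim {:XQ L} <= r)%N.
Proof.
case=> -[_ T_group] [f [fmor [g [gmor _ fK]]]].
have [gD gM greg] := gmor; have [fT fM _] := fmor.
pose e i : 'M[K]_n -> K := fun t => g t i i.
have gE t : T t -> g t = diagf (e^~ t) by move=> /gD/diag_groupP.
have e0 t : T t -> forall i, e i t != 0.
  by move=> Tt; apply/diag_groupE; rewrite -gE //; exact: gD.
have ce i : is_character T (e i).
  apply: is_characterP => [t Tt|a b Ta Tb|]; [exact: e0| |exact: greg].
  by rewrite {1}/e gM // !gE // diagfM !mxE eqxx mulr1n.
pose X := [seq wt L (e i) | i <- enum 'I_r].
suff /subvP sX : forall x, x \in fullv -> x \in <<X>>%VS.
  apply: leq_trans (dimvS sX) _; apply: leq_trans (dim_span _) _.
  by rewrite size_map size_enum_ord.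
move=> x _; have [k [chi [k0 cchi ex]]] := wt_span x.
suff wtX : wt L chi \in <<X>>%VS.
  have k0' : k%:R != 0 :> rat by rewrite pnatr_eq0 -lt0n.
  by rewrite -[x](scalerK k0') memvZ // scaler_nat ex.
have [kN chiE] := choice (fun i => torus_character_coord i T_group fmor cchi).
have prodE d : (forall j, d j != 0) ->
    chi (f (diagf d)) = \prod_i (d i ^+ (kN i).1 / d i ^+ (kN i).2).
  (* The coordinates are switched on one at a time: [c s] is [d] on [s] and 1 elsewhere. *)
  move=> d0; pose c (s : seq _) j := if j \in s then d j else 1.
  have c0 s j : c s j != 0 by rewrite /c; case: ifP; rewrite ?oner_neq0.
  have Dc s : diag_group (diagf (c s)) by apply/diag_groupE/c0.
  have : forall s, uniq s -> chi (f (diagf (c s))) =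
      \prod_(i <- s) (d i ^+ (kN i).1 / d i ^+ (kN i).2).
    elim=> [_|i s IH /= /andP[iNs us]].
      (* Here [diagf (c [::])] is the identity; its image is idempotent, so cancelling gives the
         value 1. *)
      apply: (mulfI (character_neq0 cchi (fT _ (Dc [::])))).
      rewrite -(characterM cchi) -?fM ?diagfM; try exact: Dc; try exact/fT/Dc.
      rewrite big_nil mulr1; congr (chi (f (diagf _))).
      by apply: funext => j; rewrite /c mulr1.
    have Di : diag_group (diagf (coordf i (d i))) by apply/diag_groupE/coordf_neq0.
    rewrite big_cons -IH // -chiE // -(characterM cchi); try exact: fT.
    rewrite -fM // diagfM; congr (chi (f (diagf _))); apply: funext => j.
    rewrite /c /coordf inE; have [->|_] /= := eqVneq j i; last by rewrite mul1r.
    by rewrite (negPf iNs) mulr1.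
  move=> /(_ _ (index_enum_uniq _)) <-; congr (chi (f (diagf _))).
  by apply: funext => j; rewrite /c mem_index_enum.
(* Negative exponents are moved to the side of [chi], so that only products of characters occur. *)
have cN : is_character T (fun t => \prod_i e i t ^+ (kN i).2).
  by apply: is_character_prod => i; exact: is_characterX.
have ck : is_character T (fun t => \prod_i e i t ^+ (kN i).1).
  by apply: is_character_prod => i; exact: is_characterX.
have : wt L (fun t => chi t * \prod_i e i t ^+ (kN i).2) =
    wt L (fun t => \prod_i e i t ^+ (kN i).1).
  apply/wt_eq => //; first exact: is_characterM.
  move=> t Tt; rewrite -{1}(fK t Tt) gE // prodE; last exact: e0.
  rewrite -big_split; apply: eq_bigr => i _ /=; rewrite divfK // expf_neq0 //.
  exact: e0.
rewrite wtM // !wt_prod //; try by move=> i; exact: is_characterX.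
move=> /eqP; rewrite eq_sym -subr_eq => /eqP <-.
have eX i : wt L (e i) \in <<X>>%VS.
  by apply: memv_span; apply/mapP; exists i; rewrite ?mem_enum.
by apply: memvB; apply: memv_suml => i _; rewrite wtX // rpredMn.
Qed.

End TorusRank.

(** * Computations in [SL2] transported to [G] *)

Section Coroots.
Variable K : numClosedFieldType.

(** For nonzero [c], the antidiagonal matrix with entries [c] and [- c^-1]. *)
Definition weyl2 (c : K) : 'M[K]_2 := upper2 c *m lower2 (- c^-1) *m upper2 c.

Lemma matrix2P (A B : 'M[K]_2) :
  A 0 0 = B 0 0 -> A 0 1 = B 0 1 -> A 1 0 = B 1 0 -> A 1 1 = B 1 1 -> A = B.
Proof.
have ord2 (i : 'I_2) : i = 0 \/ i = 1.
  by case: i => -[|[|//]] ?; [left|right]; apply: val_inj.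
move=> e00 e01 e10 e11; apply/matrixP => i j.
by have [->|->] := ord2 i; have [->|->] := ord2 j.
Qed.

Lemma det_matrix2 (A : 'M[K]_2) : \det A = A 0 0 * A 1 1 - A 0 1 * A 1 0.
Proof.
rewrite (expand_det_row _ 0) !big_ord_recl big_ord0 /cofactor !det_mx11 !mxE /=.
rewrite addr0 expr0 mul1r expr1 mulN1r mulrN.
by congr (A _ _ * A _ _ - A _ _ * A _ _); apply: val_inj.
Qed.

Ltac mx2 := apply: matrix2P;
  rewrite /upper2 /lower2 /torus2 ?(mxE, big_ord_recl, big_ord0) /=;
  rewrite ?mulr1n ?mulr0n.

Lemma weyl2E c : c != 0 -> weyl2 c = torus2 c *m weyl2 1.
Proof. by move=> c0; rewrite /weyl2; mx2; field. Qed.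

Lemma weyl2EV c : c != 0 -> weyl2 c = weyl2 1 *m torus2 c^-1.
Proof. by move=> c0; rewrite /weyl2; mx2; field. Qed.

Lemma upper2D a b : upper2 (a + b) = upper2 a *m upper2 b :> 'M[K]_2.
Proof. by mx2; ring. Qed.

Lemma torus2_upper2 (z : K) : z != 0 ->
  torus2 z *m upper2 1 = upper2 (z ^+ 2) *m torus2 z.
Proof. by move=> z0; mx2; field. Qed.

Lemma SL2_upper2 a : SL2 (upper2 a : 'M[K]_2).
Proof. by rewrite /SL2 /= det_matrix2 /upper2 !mxE /=; ring. Qed.

Lemma SL2_lower2 a : SL2 (lower2 a : 'M[K]_2).
Proof. by rewrite /SL2 /= det_matrix2 /lower2 !mxE /=; ring. Qed.

Lemma SL2_torus2 z : z != 0 -> SL2 (torus2 z : 'M[K]_2).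
Proof. by move=> z0; rewrite /SL2 /= det_matrix2 /torus2 !mxE /=; field. Qed.

Lemma SL2M (A B : 'M[K]_2) : SL2 A -> SL2 B -> SL2 (A *m B).
Proof. by rewrite /SL2 /= det_mulmx => -> ->; rewrite mulr1. Qed.

Lemma SL2_weyl2 c : SL2 (weyl2 c).
Proof. by apply/SL2M/SL2_upper2/SL2M/SL2_lower2/SL2_upper2. Qed.

Variables (n : nat) (G T : set 'M[K]_n).
Hypotheses (G_group : mx_subgroup G) (T_group : mx_subgroup T).

Lemma cocharacter_in mu z : is_cocharacter T mu -> z != 0 -> T (mu z).
Proof.
case=> /(_ z%:M) muT _ _ z0; move: muT; rewrite mxE eqxx mulr1n; apply.
by rewrite /GL /= unitmxE det_scalar1 unitfE.
Qed.

Variables (chi : 'M[K]_n -> K) (mu : K -> 'M[K]_n).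
Hypotheses (chi_char : is_character T chi) (mu_coroot : is_coroot G T chi mu).

(** Conjugating [phi (upper2 1)] by [mu z] gives [upper2 (chi (mu z))] by equivariance and
    [upper2 (z ^+ 2)] by computation in [SL2], both under [phi]. Only the triviality of a kernel is
    given, so it is applied to the difference of the parameters. *)
Lemma coroot_root z : z != 0 -> chi (mu z) = z ^+ 2.
Proof.
case: mu_coroot => mu_co [phi [[phiG phiM _] phi_inj upT _ muE]] z0.
have Tmu := cocharacter_in mu_co z0.
have muU := subgroup_unit T_group Tmu.
apply/eqP; rewrite -subr_eq0; apply/eqP; apply: (phi_inj _).1.
have uU a : phi (upper2 a) \in unitmx.
  exact/(subgroup_unit G_group)/phiG/SL2_upper2.
have phiU : phi (upper2 (chi (mu z))) = phi (upper2 (z ^+ 2)).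
  apply: (can_inj (mulmxK muU)); rewrite -[chi _]mulr1 -upT // mulmxKV //.
  rewrite muE // -!phiM ?torus2_upper2 //;
    by [exact: SL2_torus2 | exact: SL2_upper2].
apply: (can_inj (mulKmx (uU (z ^+ 2)))).
rewrite mulmx1 -phiM; try exact: SL2_upper2.
by rewrite -upper2D addrC subrK.
Qed.

(* The representative is phi of the antidiagonal matrix weyl2 1; it satisfies
   t g t^-1 = phi (weyl2 (chi t)) because weyl2 c is a product of root
   elements. *)
Lemma coroot_representative : exists2 g, G g & forall t, T t ->
  t *m g = mu (chi t) *m g *m t /\ t *m g = g *m mu (chi t)^-1 *m t.
Proof.
case: mu_coroot => mu_co [phi [[phiG phiM _] phi_inj upT loT muE]].
exists (phi (weyl2 1)); first exact/phiG/SL2_weyl2.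
move=> t Tt; have tU := subgroup_unit T_group Tt.
have c0 := character_neq0 chi_char Tt.
have upT' a : t *m phi (upper2 a) = phi (upper2 (chi t * a)) *m t.
  by rewrite -upT // mulmxKV.
have loT' a : t *m phi (lower2 a) = phi (lower2 ((chi t)^-1 * a)) *m t.
  by rewrite -loT // mulmxKV.
have weylE c : phi (weyl2 c) = phi (upper2 c) *m phi (lower2 (- c^-1)) *m phi (upper2 c).
  rewrite -!phiM //; do ?[exact: SL2_upper2|exact: SL2_lower2].
  by apply: SL2M; [exact: SL2_upper2|exact: SL2_lower2].
have -> : t *m phi (weyl2 1) = phi (weyl2 (chi t)) *m t.
  rewrite !weylE mulmxA mulmxA upT' -(mulmxA _ t) loT' mulmxA -(mulmxA _ t) upT'.
  by rewrite !mulmxA mulr1 invr1 mulrN1.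
rewrite !muE ?invr_eq0 // -!phiM -?weyl2E -?weyl2EV //;
  by [exact: SL2_weyl2|apply: SL2_torus2; rewrite ?invr_eq0].
Qed.

End Coroots.

(** * The Weyl group and its reflections *)

Section WeylGroup.
Variables (K : numClosedFieldType) (n : nat) (G T : set 'M[K]_n).
Hypotheses (G_group : mx_subgroup G) (T_group : mx_subgroup T).
Variable L : rational_lattices T.

Lemma normalizer_unit g : normalizer G T g -> g \in unitmx.
Proof. by case=> Gg _; exact: subgroup_unit Gg. Qed.

Lemma normalizer_conjV g t : normalizer G T g -> T t -> T (invmx g *m t *m g).
Proof.
move=> ng Tt; have gU := normalizer_unit ng; apply/(ng.2 _).
by rewrite !mulmxA mulmxV // mul1mx mulmxK.
Qed.

Lemma normalizerV g : normalizer G T g -> normalizer G T (invmx g).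
Proof.
move=> ng; have gU := normalizer_unit ng; case: G_group => _ _ _ GV.
split=> [|t]; first exact/GV/ng.1.
rewrite invmxK; split; first exact: normalizer_conjV.
by move=> /(ng.2 _).1; rewrite !mulmxA mulmxV // mul1mx mulmxK.
Qed.

Lemma normalizerM g h : normalizer G T g -> normalizer G T h -> normalizer G T (g *m h).
Proof.
move=> ng nh; have gU := normalizer_unit ng; have hU := normalizer_unit nh.
case: G_group => _ _ GM _; split=> [|t]; first exact: GM ng.1 nh.1.
by rewrite (nh.2 t) (ng.2 _) invmxM // !mulmxA.
Qed.

(** For a general endomorphism [w^-1%VF] is only a pseudo-inverse. Here [w] is onto: [wt L chi] is
    the image of the weight of [chi] conjugated by the inverse of [g]. *)
Lemma weyl_lfunVK w : weyl_group G L w -> cancel w^-1%VF w.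
Proof.
case=> g ng wE x; apply: limg_lfunVK.
have gU := normalizer_unit ng.
have [k [chi [k0 cchi ex]]] := wt_span x.
have k0' : k%:R != 0 :> rat by rewrite pnatr_eq0 -lt0n.
rewrite -[x](scalerK k0') memvZ // scaler_nat ex.
pose psi t := chi (invmx (invmx g) *m t *m invmx g).
have cpsi : is_character T psi.
  apply: is_character_conj => //; first by rewrite unitmx_inv.
  by move=> t; apply: normalizer_conjV; exact: normalizerV.
rewrite (_ : wt L chi = w (wt L psi)) ?memv_img ?memvf // wE //.
congr wt; apply: funext => t; rewrite /psi invmxK.
by rewrite !mulmxA mulmxV // mul1mx mulmxK.
Qed.

(** In finite dimension the surjective [w] is injective. *)
Lemma weyl_lfunK w : weyl_group G L w -> cancel w w^-1%VF.
Proof.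
move=> Ww; have wK := weyl_lfunVK Ww; apply: lker0_lfunK.
have full : limg w = fullv.
  by apply/vspaceP => x; rewrite memvf -[x]wK memv_img ?memvf.
have := limg_ker_dim w fullv.
by rewrite full capfv -[X in _ = X]add0n => /addIn /eqP; rewrite dimv_eq0.
Qed.

Lemma weyl_group_subgroup : end_subgroup (weyl_group G L).
Proof.
split.
- exists 1%:M.
    case: G_group => _ G1 _ _; split=> // t.
    by rewrite mul1mx invmx1 mulmx1.
  move=> chi _; rewrite id_lfunE; congr wt; apply: funext => t.
  by rewrite invmx1 mul1mx mulmx1.
- move=> u w [g ng uE] [h nh wE]; exists (g *m h); first exact: normalizerM.
  move=> chi cchi; rewrite comp_lfunE /= wE // uE.
    congr wt; apply: funext => t.
    rewrite invmxM ?(normalizer_unit ng) ?(normalizer_unit nh) //.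
    by rewrite !mulmxA.
  apply: is_character_conj => //; first exact: normalizer_unit nh.
  by move=> t; exact: normalizer_conjV.
- move=> w Ww; have wK := weyl_lfunK Ww; case: (Ww) => g ng wE.
  have gU := normalizer_unit ng.
  exists (invmx g); first exact: normalizerV.
  move=> chi cchi; pose psi t := chi (invmx (invmx g) *m t *m invmx g).
  have cpsi : is_character T psi.
    apply: is_character_conj => //; first by rewrite unitmx_inv.
    by move=> t; apply: normalizer_conjV; exact: normalizerV.
  rewrite (_ : wt L chi = w (wt L psi)) ?wK // wE //.
  congr wt; apply: funext => t; rewrite /psi invmxK.
  by rewrite !mulmxA mulmxV // mul1mx mulmxK.
Qed.

(** Applied below with [U] the span of the roots of [I], to bound how far W_I moves a vector. *)
Lemma weyl_stable_subgroup (U : {vspace XQ L}) :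
  end_subgroup [set w | weyl_group G L w /\ forall v, w v - v \in U].
Proof.
have [W1 WM WV] := weyl_group_subgroup; split.
- by split=> // v; rewrite id_lfunE subrr mem0v.
- move=> u w [Wu uU] [Ww wU]; split; first exact: WM.
  move=> v; rewrite comp_lfunE /= -(subrK (w v) (u (w v))) -addrA.
  exact: memvD.
- move=> w [Ww wU]; split; first exact: WV.
  move=> v; rewrite -[X in _ - X](weyl_lfunVK Ww) -memvN opprB.
  exact: wU.
Qed.

Section Reflection.
Variables (chi : 'M[K]_n -> K) (mu : K -> 'M[K]_n).

Let refl_fun (v : XQ L) := v - pairing L v (cowt L mu) *: wt L chi.

(** [linfun] agrees with its argument only on linear functions, so this is what allows [reflection]
    to be evaluated. *)
Fact refl_fun_linear : linear refl_fun.
Proof.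
move=> a u v; rewrite /refl_fun linearP add_lfunE scale_lfunE scalerDl scalerBr.
by rewrite !scalerA opprD addrACA.
Qed.
HB.instance Definition _ :=
  GRing.isLinear.Build rat (XQ L) (XQ L) *:%R refl_fun refl_fun_linear.

Lemma reflectionE v :
  reflection L chi mu v = v - pairing L v (cowt L mu) *: wt L chi.
Proof. exact: (lfunE refl_fun). Qed.

Hypotheses (chi_char : is_character T chi) (mu_coroot : is_coroot G T chi mu).

Lemma pairing_root_coroot : pairing L (wt L chi) (cowt L mu) = 2%:R.
Proof.
have [mu_co _] := mu_coroot.
have [m -> mE] := pairingE L chi_char mu_co.
have two0 : (2%:R : K) != 0 by rewrite pnatr_eq0.
(* Evaluation at [z = 2] determines [m], as the powers of 2 are pairwise distinct; a negative [m]
   cannot give 4. *)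
have := mE 2%:R two0; rewrite (coroot_root G_group T_group) //.
case: m {mE} => k /eqP; rewrite -natrX.
  by rewrite -exprnP -natrX eqr_nat eqn_exp2l // => /eqP <-.
rewrite NegzE -exprnN -(inj_eq (mulIf (expf_neq0 k.+1 two0))) mulVf ?expf_neq0 //.
by rewrite -natrX -natrM -[1]/(1%:R) eqr_nat -expnD -[1%N]/(2 ^ 0)%N eqn_exp2l.
Qed.

Lemma reflection_root : reflection L chi mu (wt L chi) = - wt L chi.
Proof.
by rewrite reflectionE pairing_root_coroot scaler_nat mulr2n opprD addrA subrr add0r.
Qed.

Lemma reflectionK v : reflection L chi mu (reflection L chi mu v) = v.
Proof.
rewrite [reflection L chi mu v]reflectionE linearB linearZ /= reflection_root.
by rewrite reflectionE scalerN opprK subrK.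
Qed.

(** For the representative [g], conjugation by its inverse sends [t] to [mu (chi t)^-1 *m t], which
    multiplies [psi] by the power of [chi] with exponent minus the pairing of [psi] and [mu]. *)
Lemma reflection_weyl : weyl_group G L (reflection L chi mu).
Proof.
have [mu_co _] := mu_coroot.
have [g Gg gE] := coroot_representative T_group chi_char mu_coroot.
have gU := subgroup_unit G_group Gg.
have c0 t : T t -> chi t != 0 by exact: character_neq0.
have Tmu t : T t -> T (mu (chi t)) by move=> Tt; exact: cocharacter_in mu_co (c0 t Tt).
have TmuV t : T t -> T (mu (chi t)^-1).
  by move=> Tt; apply: (cocharacter_in mu_co); rewrite invr_eq0 c0.
have [_ _ TM TV] := T_group.
have conjE t : T t -> invmx g *m t *m g = mu (chi t)^-1 *m t.
  by move=> Tt; rewrite -mulmxA (gE t Tt).2 -mulmxA mulKmx.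
have stab t : T t -> T (invmx g *m t *m g).
  by move=> Tt; rewrite conjE //; apply: TM => //; exact: TmuV.
exists g.
  split=> // t; split=> [Tt|/stab]; last first.
    by rewrite !mulmxA mulVmx // mul1mx mulmxKV.
  have -> : g *m t *m invmx g = invmx (mu (chi t)) *m t.
    have mU := subgroup_unit T_group (Tmu t Tt).
    apply: (can_inj (mulKmx mU)); rewrite mulKVmx // !mulmxA -(gE t Tt).1.
    by rewrite mulmxK.
  by apply: TM => //; exact/TV/Tmu.
move=> psi cpsi; rewrite reflectionE.
have cconj := is_character_conj gU stab cpsi.
have [m -> mE] := pairingE L cpsi mu_co.
have psiE t : T t -> psi (invmx g *m t *m g) = chi t ^ (- m) * psi t.
  move=> Tt; rewrite conjE // (characterM cpsi) //; last exact: TmuV.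
  by rewrite mE ?invr_eq0 ?c0 // exprz_inv.
(* [wtX] handles natural exponents only; the sign of [m] decides on which side the power of [chi]
   stands. *)
case: m mE psiE => k _ psiE; apply/eqP; rewrite subr_eq.
  rewrite scaler_nat -wtX // -wtM //; last exact: is_characterX.
  apply/eqP/wt_eq => //; first by apply: is_characterM => //; exact: is_characterX.
  by move=> t Tt; rewrite psiE // mulrAC -exprnN mulVf ?mul1r // expf_neq0 ?c0.
rewrite NegzE mulrNz scaleNr scaler_nat -wtX // eq_sym subr_eq -wtM //;
  last exact: is_characterX.
apply/eqP/wt_eq => //; first by apply: is_characterM => //; exact: is_characterX.
by move=> t Tt; rewrite psiE // NegzE opprK mulrC.
Qed.

End Reflection.
End WeylGroup.

(** * Weights of [T] on the matrix space and finiteness of the Weyl group *)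

Section ConjugationWeights.
Variables (K : numClosedFieldType) (n : nat) (G T : set 'M[K]_n).
Hypotheses (G_group : mx_subgroup G) (T_group : mx_subgroup T).
Variable L : rational_lattices T.

(** Taking [X] in the whole matrix space makes stability under conjugation by the normalizer
    immediate. *)
Definition conj_eigen (chi : 'M[K]_n -> K) (X : 'M[K]_n) : Prop :=
  [/\ is_character T chi, X != 0
    & forall t, T t -> t *m X *m invmx t = chi t *: X].

Definition conj_weight : set (XQ L) :=
  [set v | exists chi X, conj_eigen chi X /\ v = wt L chi].

(** Eigenvectors of distinct weights are independent: if [X v] were a combination of the others,
    conjugating by [t] and comparing with [chi v t] would give a relation among those, forcing two
    weights to coincide. *)
Lemma conj_eigen_free (chi : XQ L -> 'M[K]_n -> K) (X : XQ L -> 'M[K]_n)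
    (s : seq (XQ L)) :
  uniq s -> (forall v, v \in s -> conj_eigen (chi v) (X v) /\ v = wt L (chi v)) ->
  free [seq X v | v <- s].
Proof.
elim: s => [|v s IH] /=; first by rewrite nil_free.
move=> /andP[vNs us] sP.
have {}IH : free [seq X u | u <- s].
  by apply: IH => // u us'; apply: sP; rewrite inE us' orbT.
rewrite free_cons IH andbT; apply/negP => /(@coord_span _ _ _ (map_tuple X (in_tuple s))).
set c := coord _ => Xv.
have [[cv Xv0 vE] ev] := sP v (mem_head _ _).
have sub (i : 'I_(size s)) : s`_i \in v :: s by rewrite inE mem_nth ?orbT.
have XE (i : 'I_(size s)) : [seq X u | u <- s]`_i = X s`_i by rewrite (nth_map 0).
have c0 t i : T t -> c i (X v) * (chi v t - chi s`_i t) = 0.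
  move=> Tt.
  have : \sum_i (c i (X v) * (chi v t - chi s`_i t)) *: [seq X u | u <- s]`_i = 0.
    rewrite (eq_bigr (fun i : 'I_(size s) => chi v t *: (c i (X v) *: X s`_i)
        - t *m (c i (X v) *: X s`_i) *m invmx t)).
      rewrite big_split /= sumrN -scaler_sumr -mulmx_suml -mulmx_sumr.
      rewrite (eq_bigr (fun i => c i (X v) *: [seq X u | u <- s]`_i)); last first.
        by move=> j _; rewrite XE.
      by rewrite -Xv vE // subrr.
    move=> j _; have [[_ _ sE] _] := sP _ (sub j).
    rewrite XE -scalemxAr -scalemxAl sE // !scalerA -scalerBl.
    by rewrite mulrBr [c j _ * chi v t]mulrC.
  move=> e; have /freeP F : free (map_tuple X (in_tuple s)) by [].
  exact: (F (fun i => c i (X v) * (chi v t - chi s`_i t))).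
move/eqP: Xv0; apply; rewrite Xv big1 // => i _.
have [|ci0] := eqVneq (c i (X v)) 0; first by move=> ->; rewrite scale0r.
have [[cs _ _] es] := sP _ (sub i).
case/negP: vNs; suff -> : v = s`_i by rewrite mem_nth.
rewrite ev es; apply/wt_eq => // t Tt.
by apply/eqP; rewrite -subr_eq0; move/eqP: (c0 t i Tt); rewrite mulf_eq0 (negPf ci0).
Qed.

(** More than [n * n] weights would yield too many independent matrices. *)
Lemma conj_weight_finite : finite_set conj_weight.
Proof.
apply: contrapT => /(infinite_set_fset (n * n).+1) [B BW].
have /choice[p pP] : forall v, exists p : ('M[K]_n -> K) * 'M[K]_n,
    conj_weight v -> conj_eigen p.1 p.2 /\ v = wt L p.1.
  move=> v; have [[chi [X e]]|nW] := pselect (conj_weight v); first by exists (chi, X).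
  by exists (fun=> 0, 0) => /nW.
have : free [seq (p v).2 | v <- enum_fset B].
  apply: (@conj_eigen_free (fun v => (p v).1)); first exact: fset_uniq.
  by move=> v vB; exact/pP/BW.
rewrite /free size_map => /eqP e; apply/negP; rewrite -ltnNge ltnS.
have <- : \dim {:'M[K]_n} = (n * n)%N by rewrite dimvf dim_matrix.
by rewrite -[X in (X <= _)%N]e; exact/dimvS/subvf.
Qed.

(** If [X] is an eigenvector for [v], its conjugate by a representative of [w] is one for [w v]. *)
Lemma weyl_conj_weight w v : weyl_group G L w -> conj_weight v -> conj_weight (w v).
Proof.
case=> g ng wE [chi [X [[cchi X0 XE] ->]]].
have gU := normalizer_unit G_group ng.
exists (fun t => chi (invmx g *m t *m g)), (g *m X *m invmx g); split; last exact: wE.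
split.
- apply: is_character_conj => //.
  by move=> t; exact: (normalizer_conjV G_group ng).
- apply: contra X0 => /eqP e; apply/eqP.
  by rewrite -[X](mulKmx gU) -[g *m X](mulmxKV gU) e mul0mx mulmx0.
move=> t Tt; have Tt' := normalizer_conjV G_group ng Tt.
set t' := (X in chi X); rewrite -/t' in Tt'.
have tgV : invmx g *m t = t' *m invmx g by rewrite /t' mulmxK.
have tg : t *m g = g *m t' by rewrite /t' !mulmxA mulmxV // mul1mx.
have t'U := subgroup_unit T_group Tt'; have tU := subgroup_unit T_group Tt.
move: t' Tt' t'U tgV tg => t' Tt' t'U tgV tg.
apply: (can_inj (mulmxK tU)); rewrite mulmxKV //.
rewrite -scalemxAl -!mulmxA tgV scalemxAr scalemxAl -XE //.
by rewrite !mulmxA mulmxKV // tg.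
Qed.

Lemma weyl_group_finite (X : seq (XQ L)) :
  (forall v, v \in X -> conj_weight v) -> <<X>>%VS = fullv ->
  finite_set (weyl_group G L).
Proof.
move=> XW Xfull; pose F := fset_set conj_weight.
have inF v : (v \in F) = (v \in conj_weight).
  by rewrite in_fset_set //; exact: conj_weight_finite.
pose P (h : {ffun 'I_(size X) -> F}) : set 'End(XQ L) :=
  [set w | forall i : 'I_(size X), w X`_i = val (h i)]%classic.
(* At most one endomorphism has the values [h] on the spanning family [X]. [xget] picks it, or 0 if
   there is none, so finitely many [h] account for the whole group. *)
apply: (@sub_finite_set _ _ [set xget 0 (P h) | h in setT]%classic); last first.
  exact/finite_image/finite_finset.
move=> w Ww.
have wF (i : 'I_(size X)) : w X`_i \in F.
  by rewrite inF in_setE; apply: weyl_conj_weight => //; apply/XW/mem_nth.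
exists [ffun i => [` wF i]%fset] => //; apply: xget_unique.
  by move=> i; rewrite ffunE.
move=> u uP; apply/lfunP => x; have : x \in <<X>>%VS by rewrite Xfull memvf.
move: x; apply/span_lfunP => _ /(nthP 0)[i iX <-].
by rewrite (uP (Ordinal iX)) ffunE.
Qed.

End ConjugationWeights.

(** * Sums and averages over W_I *)

Lemma sumr_const_seq (V : nmodType) (U : Type) (e : seq U) (v : V) :
  \sum_(u <- e) v = v *+ size e.
Proof. by rewrite big_const_seq count_predT iter_addr_0. Qed.

(** Reindexes sums over W_I by composition with a reflection on either side. *)
Lemma sum_fset_involution (U : choiceType) (V : zmodType) (A : {fset U})
    (f : U -> U) (F : U -> V) :
  (forall u, u \in A -> f u \in A) -> involutive f ->
  \sum_(u <- A) F (f u) = \sum_(u <- A) F u.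
Proof.
move=> fA fK; rewrite -(big_map f xpredT F) /=; apply: perm_big.
apply: uniq_perm; rewrite ?map_inj_uniq //; first exact: inv_inj.
move=> u; apply/mapP/idP => [[v vA ->]|uA]; first exact: fA.
by exists (f u); rewrite ?fK //; exact: fA.
Qed.

Section ParabolicAverage.
Variables (K : numClosedFieldType) (n r : nat) (G T : set 'M[K]_n).
Hypotheses (G_group : mx_subgroup G) (T_group : mx_subgroup T).
Variables (L : rational_lattices T) (alpha : 'I_r -> 'M[K]_n -> K).
Variables (alphav : 'I_r -> K -> 'M[K]_n) (x : 'I_r -> YQ L).
Hypothesis alpha_char : forall i, is_character T (alpha i).
Hypothesis alphav_coroot : forall i, is_coroot G T (alpha i) (alphav i).
Hypothesis x_dual :
  forall i j, pairing L (wt L (alpha i)) (x j) = (i == j)%:R.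
Hypothesis dim_XQ : (\dim {:XQ L} <= r)%N.
Hypothesis W_finite : finite_set (weyl_group G L).
Variables I J : {set 'I_r}.
Hypotheses (IJ_disj : [disjoint I & J]) (IJ_cover : I :|: J = [set: 'I_r]).

Local Notation WI := (weyl_parabolic G L alpha alphav I).
Local Notation sref i := (reflection L (alpha i) (alphav i)).
Let rootspan : {vspace XQ L} := <<[seq wt L (alpha i) | i <- enum I]>>%VS.

Lemma pairingDl u v y : pairing L (u + v) y = pairing L u y + pairing L v y.
Proof. by rewrite linearD add_lfunE. Qed.

Lemma pairingZl a u y : pairing L (a *: u) y = a *: pairing L u y.
Proof. by rewrite linearZ /= scale_lfunE. Qed.

Lemma pairing_suml (H : Type) (e : seq H) (F : H -> XQ L) y :
  pairing L (\sum_(i <- e) F i) y = \sum_(i <- e) pairing L (F i) y.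
Proof. by rewrite linear_sum sum_lfunE. Qed.

Lemma simple_root_coord (c : 'I_r -> rat) j :
  pairing L (\sum_i c i *: wt L (alpha i)) (x j) = c j.
Proof.
rewrite pairing_suml (bigD1 j) //= big1 ?addr0 => [|i ij].
  by rewrite pairingZl x_dual eqxx [LHS]mulr1.
by rewrite pairingZl x_dual (negPf ij) scaler0.
Qed.

(** Duality with [x] makes the [r] simple roots independent, and the dimension is at most [r]. *)
Lemma simple_roots_span :
  <<[tuple wt L (alpha i) | i < r]>>%VS = fullv.
Proof.
apply/eqP; rewrite eqEdim subvf (leq_trans dim_XQ) //.
set X := [tuple _ | _ < r]; suff /eqP -> : free X by rewrite size_tuple.
apply/freeP => k; under eq_bigr do rewrite nth_mktuple.
move=> k0 j.
by rewrite -(simple_root_coord k) k0 linear0 zero_lfunE.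
Qed.

Lemma simple_root_decomp v :
  v = \sum_i pairing L v (x i) *: wt L (alpha i).
Proof.
have : v \in <<[tuple wt L (alpha i) | i < r]>>%VS.
  by rewrite simple_roots_span memvf.
move=> /coord_span; under eq_bigr do rewrite nth_mktuple.
move=> e; rewrite {1}e; apply: eq_bigr => i _; congr (_ *: _).
by rewrite [in RHS]e simple_root_coord.
Qed.

Lemma pairing_rootspan v j : v \in rootspan -> j \in J -> pairing L v (x j) = 0.
Proof.
move=> vS jJ; have := @coord_span _ _ _ (in_tuple _) _ vS => ->.
rewrite pairing_suml big1 // => i _.
have /mapP[k kI ->] := mem_nth 0 (ltn_ord i).
rewrite pairingZl x_dual; have [kj|_] := eqVneq k j; last exact: scaler0.
by move: kI; rewrite mem_enum kj => /(disjointFr IJ_disj); rewrite jJ.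
Qed.

(** The coefficient of the [j]-th simple root in [v] is the pairing with [x j], so only roots of [I]
    remain. *)
Lemma mem_rootspan v : (forall j, j \in J -> pairing L v (x j) = 0) -> v \in rootspan.
Proof.
move=> v0; rewrite (simple_root_decomp v); apply: memv_suml => i _.
have : i \in I :|: J by rewrite IJ_cover inE.
rewrite inE => /orP[iI|/v0 ->]; last by rewrite scale0r mem0v.
by apply/memvZ/memv_span/mapP; exists i; rewrite ?mem_enum.
Qed.

(** The induction principle for W_I. *)
Lemma parabolic_sub (H : set 'End(XQ L)) : end_subgroup H ->
  (H `<=` weyl_group G L)%classic -> (forall i, i \in I -> H (sref i)) ->
  (WI `<=` H)%classic.
Proof. by move=> Hg HW Hs w; apply. Qed.

Lemma parabolic_weyl : (WI `<=` weyl_group G L)%classic.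
Proof.
apply: parabolic_sub => //; first exact: weyl_group_subgroup.
by move=> i _; apply: reflection_weyl.
Qed.

Lemma parabolic_finite : finite_set WI.
Proof. exact: sub_finite_set parabolic_weyl W_finite. Qed.

Lemma parabolic_displacement w v : WI w -> w v - v \in rootspan.
Proof.
move=> Ww; suff : (weyl_group G L w /\ forall v, w v - v \in rootspan) by case.
move: w Ww; apply: parabolic_sub; first exact: weyl_stable_subgroup.
  by move=> w [].
move=> i iI; split=> [|u]; first exact: reflection_weyl.
rewrite reflectionE addrAC subrr sub0r memvN memvZ //.
by apply/memv_span/mapP; exists i; rewrite ?mem_enum.
Qed.

(** The stabilizer of [u] in the Weyl group is a subgroup. *)
Lemma parabolic_fix u : (forall i, i \in I -> sref i u = u) ->
  forall w, WI w -> w u = u.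
Proof.
move=> su w Ww; suff : weyl_group G L w /\ w u = u by case.
have [W1 WM WV] := weyl_group_subgroup G_group L.
move: w Ww; apply: parabolic_sub; [split|by move=> w []|].
- by rewrite id_lfunE.
- move=> v w [Wv vu] [Ww wu]; split; first exact: WM.
  by rewrite comp_lfunE /= wu.
- move=> w [Ww wu]; split; first exact: WV.
  by rewrite -[X in _ X = _]wu (weyl_lfunK G_group Ww).
- by move=> i iI; split; [exact: reflection_weyl | exact: su].
Qed.

Let WIset := fset_set WI.

Lemma mem_WIset w : w \in WIset <-> WI w.
Proof. by rewrite in_fset_set ?in_setE //; exact: parabolic_finite. Qed.

Lemma parabolic_1 : WI \1%VF.
Proof. by move=> H [H1 _ _]. Qed.

Lemma parabolic_reflection i w : i \in I -> WI w ->
  WI (sref i \o w)%VF /\ WI (w \o sref i)%VF.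
Proof.
by move=> iI Ww; split=> H Hg HW Hs; case: (Hg) => _ HM _;
   apply: HM; first [exact: Hs | exact: Ww].
Qed.

Lemma reflection_comp i : (sref i \o sref i)%VF = \1%VF.
Proof.
apply/lfunP => v.
by rewrite comp_lfunE id_lfunE /= (reflectionK G_group T_group).
Qed.

(** Left composition with the reflection permutes W_I. *)
Lemma sum_parabolic_fix i v : i \in I ->
  sref i (\sum_(w <- WIset) w v) = \sum_(w <- WIset) w v.
Proof.
move=> iI; rewrite linear_sum /=.
rewrite -[RHS](sum_fset_involution (f := fun w => (sref i \o w)%VF)).
- by apply: eq_bigr => w _; rewrite comp_lfunE.
- by move=> w /mem_WIset Ww; apply/mem_WIset; case: (parabolic_reflection iI Ww).
- by move=> w; rewrite comp_lfunA reflection_comp comp_lfun1l.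
Qed.

(** Right composition with the reflection permutes W_I and changes the sign of each term. *)
Lemma sum_parabolic_root i : i \in I ->
  \sum_(w <- WIset) w (wt L (alpha i)) = 0.
Proof.
move=> iI; set S := \sum_(w <- _) _.
suff SN : S = - S.
  apply/eqP; move/eqP: SN; rewrite -addr_eq0 -mulr2n -scaler_nat scaler_eq0.
  by rewrite pnatr_eq0.
rewrite -{1}[S]/(\sum_(w <- WIset) w (wt L (alpha i))).
rewrite -(sum_fset_involution (f := fun w => (w \o sref i)%VF)).
- rewrite -sumrN; apply: eq_bigr => w _.
  by rewrite comp_lfunE /= (reflection_root G_group T_group) // linearN.
- by move=> w /mem_WIset Ww; apply/mem_WIset; case: (parabolic_reflection iI Ww).
- by move=> w; rewrite -comp_lfunA reflection_comp comp_lfun1r.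
Qed.

Lemma sum_parabolic_rootspan v : v \in rootspan -> \sum_(w <- WIset) w v = 0.
Proof.
move=> vS; rewrite -sum_lfunE -[RHS](zero_lfunE _ v).
move: v vS; apply/span_lfunP => _ /mapP[i iI ->].
by rewrite sum_lfunE zero_lfunE sum_parabolic_root // -mem_enum.
Qed.

Lemma card_WIset_neq0 : #|` WIset|%:R != 0 :> rat.
Proof.
rewrite pnatr_eq0 -lt0n cardfs_gt0; apply/fset0Pn; exists \1%VF.
by apply/mem_WIset; exact: parabolic_1.
Qed.

Lemma vIJ_average lambda : vIJ L alphav x I J lambda =
  #|` WIset|%:R^-1 *: \sum_(w <- WIset) w (wt L lambda).
Proof.
set v := RHS; have N0 := card_WIset_neq0.
have sv i : i \in I -> sref i v = v.
  by move=> iI; rewrite linearZ /= sum_parabolic_fix.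
have pair_fix u i : sref i u = u <-> pairing L u (cowt L (alphav i)) = 0.
  rewrite reflectionE; split=> [/eqP|->]; last by rewrite scale0r subr0.
  rewrite -subr_eq0 addrAC subrr sub0r oppr_eq0 scaler_eq0 => /orP[/eqP //|/eqP a0].
  (* A simple root has nonzero weight because it pairs to 1 with [x i]. *)
  have := x_dual i i; rewrite a0 linear0 zero_lfunE eqxx => /eqP.
  by rewrite eq_sym oner_eq0.
have vJ j : j \in J -> pairing L (wt L lambda - v) (x j) = 0.
  move=> jJ; apply: pairing_rootspan jJ; rewrite -memvN opprB.
  (* [v - wt L lambda] becomes the average of the displacements of [wt L lambda] under W_I. *)
  rewrite -[wt L lambda](scalerK N0) -scalerBr memvZ //.
  rewrite scaler_nat -sumr_const_seq -sumrB big_seq.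
  by apply: memv_suml => w /mem_WIset Ww; exact: parabolic_displacement.
(* The average is the only solution, so the default 0 of [xget] in [vIJ] does not intervene. *)
apply: xget_unique; first by split=> // i iI; exact/pair_fix/sv.
move=> y [yI yJ]; apply/eqP; rewrite -subr_eq0; apply/eqP.
have su i : i \in I -> sref i (y - v) = y - v.
  move=> iI; rewrite linearB /= sv //; congr (_ - _).
  exact/pair_fix/yI.
have uS : y - v \in rootspan.
  apply: mem_rootspan => j jJ.
  have -> : y - v = (wt L lambda - v) + -1 *: (wt L lambda - y).
    by rewrite scaleN1r opprB [RHS]addrC addrA subrK.
  by rewrite pairingDl pairingZl vJ // yJ // scaler0 addr0.
(* The sum of the images of [y - v] is 0, yet also a nonzero multiple of [y - v], which W_I
   fixes. *)
have := sum_parabolic_rootspan uS.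
rewrite big_seq (eq_bigr (fun=> y - v)) => [|w /mem_WIset Ww]; last first.
  exact: parabolic_fix Ww.
rewrite -big_seq sumr_const_seq -scaler_nat => /eqP.
by rewrite scaler_eq0 (negPf N0) => /eqP.
Qed.

End ParabolicAverage.

(** Finiteness is part of the conclusion because [fset_set] of an infinite set is empty, which would
    make the formula meaningless. *)
Theorem proposition3p8 (R : realType) (n r : nat)
    (G T B : set 'M[R[i]]_n)
    (G_simple : simple_group G)
    (G_sc : simply_connected G)
    (T_max : maximal_torus G T)
    (G_rank : torus_of_dim r T)
    (B_borel : borel_subgroup G B)
    (TB : (T `<=` B)%classic)
    (alpha : 'I_r -> 'M[R[i]]_n -> R[i])
    (alphaP : enumerates_simple_roots B T alpha)
    (alphav : 'I_r -> R[i] -> 'M[R[i]]_n)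
    (alphavP : forall i, is_coroot G T (alpha i) (alphav i))
    (L : rational_lattices T)
    (x : 'I_r -> YQ L)
    (x_dual : forall i j, pairing L (wt L (alpha i)) (x j) = (i == j)%:R)
    (lambda : 'M[R[i]]_n -> R[i])
    (lambda_char : is_character T lambda)
    (lambda_dom : dominant L alphav lambda)
    (I J : {set 'I_r})
    (IJ_disj : [disjoint I & J])
    (IJ_cover : I :|: J = [set: 'I_r]) :
  let WI := weyl_parabolic G L alpha alphav I in
  finite_set WI /\
  vIJ L alphav x I J lambda =
    (#|` fset_set WI |%:R)^-1 *: \sum_(w <- fset_set WI) w (wt L lambda).
Proof.
have G_group : mx_subgroup G by case: G_simple => -[].
have T_group : mx_subgroup T by case: T_max => -[d [[]]].
have alpha_root i := (alphaP.1 i).1.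
have alpha_char i : is_character T (alpha i) by case: (alpha_root i).
have dimX := dim_XQ_le L G_rank.
have W_fin : finite_set (weyl_group G L).
  (* The simple roots span, and their root vectors in the Lie algebra of [B] show that they are
     weights of conjugation. *)
  apply: weyl_group_finite (simple_roots_span x_dual dimX) => //.
  move=> _ /mapP[i _ ->]; have [_ _ [X [_ X0 XE]]] := alpha_root i.
  by exists (alpha i), X.
split; first exact: parabolic_finite.
exact: vIJ_average.
Qed.
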